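(* Let $\Omega\subset\mathbb{R}^3$ be a bounded domain with $\partial\Omega\in C^{1,\alpha}$, $0<\alpha\le1$. Suppose $u\in C^2(\Omega)$ and $\Delta u=0$ in $\Omega$. Let $P_0\in\partial\Omega$ be such that $u$ is continuous at $P_0$ and $u(P_0)>u(P)$ for all $P\in\Omega$. Then the exterior normal derivative of $u$ at $P_0$, if it exists, satisfies the strict inequality $$\frac{\partial u}{\partial n}(P_0)=\lim_{P\to n_{P_0}^{-}}\frac{u(P_0)-u(P)}{r_{P_0P}}>0 .$$
   Context: $r_{P_0P}=|P_0-P|$; $n_{P_0}$ is the exterior unit normal to $\partial\Omega$ at $P_0$; $P\to n_{P_0}^{-}$ means that $P$ tends to $P_0$ along the normal line through $P_0$ from the interior of $\Omega$. $\partial\Omega\in C^{1,\alpha}$ means: each point of $\partial\Omega$ has a neighbourhood in which $\partial\Omega$ is the graph of a $C^{1,\alpha}$ function of two of the three coordinates, with $\Omega$ locally on exactly one side of the graph. *)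

(* Defs.v *)
From HB Require Import structures.
From mathcomp Require Import all_boot all_order all_algebra.
From mathcomp Require Import all_classical all_reals all_analysis.

Set Implicit Arguments.
Unset Strict Implicit.
Unset Printing Implicit Defensive.

Import Order.TTheory GRing.Theory Num.Theory.
Import numFieldNormedType.Exports.

Local Open Scope ring_scope.
Local Open Scope classical_set_scope.

Section Defs.
Context {R : realType}.

(* The library norm on row vectors is the sup norm; distances in the
   statement are Euclidean. *)
Definition enorm n (x : 'rV[R]_n) : R := Num.sqrt (\sum_i x 0 i ^+ 2).

Definition ebase n (i : 'I_n) : 'rV[R]_n := delta_mx 0 i.

Definition partial n (i : 'I_n.+1) (f : 'rV[R]_n.+1 -> R) : 'rV[R]_n.+1 -> R :=
  fun x => 'D_(ebase i) f x.

Definition C1_on n (D : set 'rV[R]_n.+1) (f : 'rV[R]_n.+1 -> R) : Prop :=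
  forall x, D x -> {for x, continuous f} /\
    forall i, derivable f x (ebase i) /\ {for x, continuous (partial i f)}.

Definition C2_on n (D : set 'rV[R]_n.+1) (f : 'rV[R]_n.+1 -> R) : Prop :=
  C1_on D f /\ forall i, C1_on D (partial i f).

Definition C1alpha_on n (alpha : R) (D : set 'rV[R]_n.+1)
    (f : 'rV[R]_n.+1 -> R) : Prop :=
  C1_on D f /\
  exists C : R, forall i x y, D x -> D y ->
    `|partial i f x - partial i f y| <= C * enorm (x - y) `^ alpha.

Definition laplacian n (f : 'rV[R]_n.+1 -> R) : 'rV[R]_n.+1 -> R :=
  fun x => \sum_i partial i (partial i f) x.

Definition domain n (D : set 'rV[R]_n.+1) : Prop :=
  [/\ open D, connected D & D !=set0].

Definition boundary (T : topologicalType) (D : set T) : set T :=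
  closure D `\` interior D.

(* The two coordinates of a point of R^3 other than the i-th one. *)
Definition other_coords (i : 'I_3) (x : 'rV[R]_3) : 'rV[R]_2 := col' i x.

(* Vanishes exactly on the graph x_i = phi(other coordinates); [s] selects the
   side on which it is negative: below the graph when [s = false], above it
   when [s = true]. *)
Definition graph_fun (i : 'I_3) (s : bool) (phi : 'rV[R]_2 -> R)
    (x : 'rV[R]_3) : R :=
  (-1) ^+ s * (x 0 i - phi (other_coords i x)).

(* In the neighbourhood U of Q, the boundary of Omega is the graph of phi and
   Omega is exactly the side where [graph_fun i s phi] is negative. *)
Record C1alpha_chart (Omega : set 'rV[R]_3) (alpha : R) (Q : 'rV[R]_3)
    (i : 'I_3) (s : bool) (U : set 'rV[R]_3) (W : set 'rV[R]_2)
    (phi : 'rV[R]_2 -> R) : Prop := C1alphaChart {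
  chart_open : open U ;
  chart_mem : U Q ;
  chart_base_open : open W ;
  chart_base : forall x, U x -> W (other_coords i x) ;
  chart_C1alpha : C1alpha_on alpha W phi ;
  chart_boundary : forall x, U x ->
    (boundary Omega x <-> graph_fun i s phi x = 0) ;
  chart_side : forall x, U x -> (Omega x <-> graph_fun i s phi x < 0)
}.

Definition C1alpha_boundary (Omega : set 'rV[R]_3) (alpha : R) : Prop :=
  forall Q, boundary Omega Q ->
    exists i s U W phi, C1alpha_chart Omega alpha Q i s U W phi.

(* The gradient of [graph_fun i s phi] at Q; it points out of Omega because
   Omega is the side where that function is negative. *)
Definition outward_vector (i : 'I_3) (s : bool) (phi : 'rV[R]_2 -> R)
    (Q : 'rV[R]_3) : 'rV[R]_3 :=
  (-1) ^+ s *: (ebase i -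
    \sum_(j < 2) partial j phi (other_coords i Q) *: ebase (lift i j)).

Definition exterior_unit_normal (Omega : set 'rV[R]_3) (alpha : R)
    (Q nu : 'rV[R]_3) : Prop :=
  exists i s U W phi, C1alpha_chart Omega alpha Q i s U W phi /\
    nu = (enorm (outward_vector i s phi Q))^-1 *: outward_vector i s phi Q.

Definition normal_line (P0 nu : 'rV[R]_3) : set 'rV[R]_3 :=
  [set P | exists t : R, P = P0 + t *: nu].

(* P tends to P0 along the normal line through P0, from inside Omega. *)
Definition interior_normal_filter (Omega : set 'rV[R]_3) (P0 nu : 'rV[R]_3) :
    set_system 'rV[R]_3 :=
  within (Omega `&` normal_line P0 nu) (nbhs P0).

Definition normal_quotient (u : 'rV[R]_3 -> R) (P0 P : 'rV[R]_3) : R :=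
  (u P0 - u P) / enorm (P0 - P).

Definition normal_derivable (Omega : set 'rV[R]_3) (u : 'rV[R]_3 -> R)
    (P0 nu : 'rV[R]_3) : Prop :=
  cvg (normal_quotient u P0 @ interior_normal_filter Omega P0 nu).

Definition normal_derivative (Omega : set 'rV[R]_3) (u : 'rV[R]_3 -> R)
    (P0 nu : 'rV[R]_3) : R :=
  lim (normal_quotient u P0 @ interior_normal_filter Omega P0 nu).

End Defs.

(* Main.v *)
Require Import Defs.
From HB Require Import structures.
From mathcomp Require Import all_boot all_order all_algebra.
From mathcomp Require Import all_classical all_reals all_analysis.
From mathcomp Require Import ring lra.

Import Order.TTheory GRing.Theory Num.Theory.
Import numFieldNormedType.Exports.

Local Open Scope ring_scope.
Local Open Scope classical_set_scope.

(** This is the Hopf boundary lemma, proved by comparing [u] with an explicit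
    strictly subharmonic barrier.

    Put [y = <nu, z - P0>], where [nu] is the interior unit normal, and
    [e = |z - P0|].  Holder continuity of the gradient of the boundary graph
    gives a Taylor remainder of order [1 + alpha], so near [P0] the set
    [K e^(1+alpha) <= y] without [P0] lies in Omega
    ([C1alpha_chart_inner_paraboloid]).  This region need not contain a ball
    touching the boundary at [P0], hence the usual radial barrier is replaced by

      [v = y - A e^(1+alpha) + B y^(1+alpha)].

    The term [e^(1+alpha)] pushes [v] below zero outside the paraboloid, at the
    price of a negative Laplacian of size [e^(alpha-1)].  The term
    [y^(1+alpha)] has a positive Laplacian of size [y^(alpha-1)], and
    [y^(alpha-1) >= e^(alpha-1)] because [y <= e] and [alpha <= 1]; so [v] is
    strictly subharmonic where [y > 0] once [B] is large compared with [A]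
    ([barrier_laplacian_gt0]).  At small scale [B y^(1+alpha) <= y], so
    [v >= 0] and [y >= 0] force [A e^(1+alpha) <= 2 y]: with [A = 2 K] the set
    [{e <= r, y >= 0, v >= 0}] lies in the paraboloid.

    On this compact set [u + eps v] attains its maximum.  An interior maximum
    with [v > 0] is impossible, since the Laplacian of [u + eps v] is positive
    ([no_interior_max]).  On the rest of the set [u + eps v <= u P0]: at [P0] by
    equality, where [v = 0] because [u < u P0], and where [e = r] for small
    [eps], by compactness.  Hence [u P0 - u >= eps v] ([barrier_comparison]).
    Along the normal [v >= y], so the difference quotients are at least [eps],
    and so is their limit. *)

(** * One-variable calculus along lines *)

(** If [c < 0], then [f'] vanishes at [x] and is negative just after it, so the
    mean value theorem makes [f] drop below [f x]. *)
Lemma second_derivative_ge0_at_min {R : realType} (f f' : R -> R) (x c : R) :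
  (\forall t \near x, is_derive (t : R) 1 f (f' t)) -> is_derive x 1 f' c ->
  (\forall t \near x, f x <= f t) -> 0 <= c.
Proof.
move=> df df' fmin; rewrite leNgt; apply/negP => c_lt0.
have [e e0 He] : exists2 e : R, 0 < e &
    forall t, `|x - t| < e -> is_derive t 1 f (f' t) /\ f x <= f t.
  have : nbhs x [set t : R | is_derive t 1 f (f' t) /\ f x <= f t].
    exact: filterI.
  by move=> /nbhs_ballP[e /= e0 He]; exists e.
have in_e t : t \in `](x - e), (x + e)[%R -> `|x - t| < e.
  by rewrite in_itv/= => /andP[? ?]; rewrite ltr_norml; apply/andP; split; lra.
have f'x0 : f' x = 0.
  have xI : x \in `](x - e), (x + e)[%R.
    by rewrite in_itv/=; apply/andP; split; lra.
  have fx0 : is_derive x 1 f 0.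
    apply: (@derive1_at_min _ f (x - e) (x + e)) => //; first lra.
      by move=> t /in_e /He [[]].
    by move=> t /in_e /He [].
  have [fx _] := He x (in_e x xI).
  by rewrite -(@derive_val _ _ _ _ _ _ _ fx) (@derive_val _ _ _ _ _ _ _ fx0).
have f'_neg : \forall h \near 0^', h^-1 * f' (h + x) < 0.
  have [cv vl] := df'.
  have {cv} : h^-1 *: ((f' \o shift x) (h *: 1) - f' x) @[h --> 0^'] --> c.
    by rewrite -vl; exact: cv.
  move=> /(cvgr_lt c) /(_ 0 c_lt0); apply: filterS => h /=.
  by rewrite f'x0 subr0 scaler1.
have [d d0 Hd] : exists2 d : R, 0 < d &
    forall h, 0 < h < d -> f' (h + x) < 0.
  have /nbhs_ballP[d d0 Hd] := f'_neg; exists d => // h /andP[h0 hd].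
  have : h^-1 * f' (h + x) < 0.
    apply: Hd; last by rewrite gt_eqF.
    by rewrite -ball_normE/= sub0r normrN gtr0_norm.
  by rewrite pmulr_rlt0 ?invr_gt0.
pose h := Num.min d e / 2.
have h0 : 0 < h by rewrite divr_gt0// lt_min d0.
have [hd he] : h < d /\ h < e.
  have : Num.min d e <= d by rewrite ge_min lexx.
  have : Num.min d e <= e by rewrite ge_min lexx orbT.
  by move: h0; rewrite /h; split; lra.
have sub t : x <= t <= x + h -> `|x - t| < e.
  by move=> /andP[? ?]; rewrite ltr_norml; apply/andP; split; lra.
have [|||xi] := @MVT _ f f' x (x + h).
- lra.
- move=> t; rewrite in_itv/= => /andP[? ?]; apply: (proj1 (He _ _)).
  by apply: sub; apply/andP; split; lra.
- apply: derivable_within_continuous => t; rewrite in_itv/= => xt.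
  by have [[]] := He _ (sub _ xt).
rewrite in_itv/= => /andP[xxi xih] fE.
have : f x <= f (x + h).
  by apply: (proj2 (He _ _)); apply: sub; apply/andP; split; lra.
have : f' xi < 0.
  by have := Hd (xi - x); rewrite subrK; apply; apply/andP; split; lra.
nra.
Qed.

(** Turns directional derivatives into ordinary ones, to which the one-variable
    mean value and maximum theorems apply. *)
Lemma is_derive_along_line {R : realType} {V : normedModType R}
    (f : V -> R) (x v : V) (t : R) :
  derivable f (x + t *: v) v ->
  is_derive t 1 (fun s : R => f (x + s *: v)) ('D_v f (x + t *: v)).
Proof.
have E : (fun h : R => h^-1 *: (((fun s => f (x + s *: v)) \o shift t) (h *: 1)
             - f (x + t *: v))) =
         (fun h => h^-1 *:
           ((f \o shift (x + t *: v)) (h *: v) - f (x + t *: v))).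
  apply/funext => h /=; congr (_ *: (f _ - _)).
  by rewrite scaler1 scalerDl addrCA.
by move=> fd; split; rewrite /derivable /derive E.
Qed.

(** The absolute value matters: [t `^ p] is 1 for negative [t], hence
    discontinuous at 0. *)
Lemma continuous_norm_powR {R : realType} (p : R) :
  0 < p -> continuous (fun t : R => `|t| `^ p).
Proof.
move=> p0 t; have [->|t0] := eqVneq t 0.
  rewrite /continuous_at normr0 powR0 ?gt_eqF//.
  apply/cvgrPdist_lt => /= e e0; near=> x.
  rewrite sub0r normrN ger0_norm ?powR_ge0//.
  have -> : e = (e `^ p^-1) `^ p.
    by rewrite -powRrM mulVf ?gt_eqF// powRr1// ltW.
  rewrite gt0_ltr_powR ?nnegrE ?powR_ge0//.
  near: x; apply/nbhs_ballP; exists (e `^ p^-1) => /=; first exact: powR_gt0.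
  by move=> x /=; rewrite sub0r normrN.
apply: (@continuous_comp _ _ _ (fun t : R => `|t|) (fun t => t `^ p)).
  exact: norm_continuous.
apply/differentiable_continuous/derivable1_diffP.
by apply: derivable_powR; rewrite in_itv/= andbT normr_gt0.
Unshelve. all: by end_near. Qed.

Lemma is_derive_powR_comp {R : realType} (f : R -> R) (p t df : R) :
  0 < f t -> is_derive t 1 f df ->
  is_derive t 1 (fun s => f s `^ p) (p * f t `^ (p - 1) * df).
Proof.
move=> ft0 fd; apply: (@is_derive1_comp _ (fun x => x `^ p) f).
exact: is_derive1_powR.
Qed.

Lemma near_line {R : realType} {d : nat} (z v : 'rV[R]_d)
    (P : 'rV[R]_d -> Prop) :
  (\forall w \near z, P w) -> \forall t \near (0 : R), P (z + t *: v).
Proof.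
move=> Pz; have cl : z + t *: v @[t --> (0 : R)] --> z.
  rewrite -{2}(addr0 z) -(scale0r v).
  apply: (@cvgD _ 'rV[R]_d _ _ _ (cst z) (fun t => t *: v)).
    exact: cvg_cst.
  by apply: (@cvgZr_tmp _ 'rV[R]_d); exact: cvg_id.
exact: cl Pz.
Qed.

Lemma continuous_shift_sub {R : realType} (V : normedModType R) (a : V) :
  continuous (fun z : V => z - a).
Proof. by move=> z; apply: cvgB; [exact: cvg_id|exact: cvg_cst]. Qed.

(** * Euclidean scalar product and norm *)

Section Euclidean.
Context {R : realType} {d : nat}.
Implicit Types (x y : 'rV[R]_d) (t : R).

Definition dotv x y : R := \sum_i x 0 i * y 0 i.

Lemma dotvDr x y z : dotv x (y + z) = dotv x y + dotv x z.
Proof. by rewrite -big_split; apply: eq_bigr => i _; rewrite mxE mulrDr. Qed.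

Lemma dotvZr x t y : dotv x (t *: y) = t * dotv x y.
Proof. by rewrite mulr_sumr; apply: eq_bigr => i _; rewrite mxE mulrCA. Qed.

Lemma dotvC x y : dotv x y = dotv y x.
Proof. by apply: eq_bigr => i _; rewrite mulrC. Qed.

Lemma dotv0r x : dotv x 0 = 0.
Proof. by rewrite -(scale0r 0) dotvZr mul0r. Qed.

Lemma dotvNr x y : dotv x (- y) = - dotv x y.
Proof. by rewrite -scaleN1r dotvZr mulN1r. Qed.

Lemma dotv_ebase x i : dotv x (ebase i) = x 0 i.
Proof.
rewrite /dotv (bigD1 i)//= big1 ?addr0 ?mxE ?eqxx ?mulr1// => j /negPf ji.
by rewrite mxE ji andbF mulr0.
Qed.

Lemma dotvv_ge0 x : 0 <= dotv x x.
Proof. by apply: sumr_ge0 => i _; rewrite -expr2 sqr_ge0. Qed.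

Lemma enormE x : enorm x = Num.sqrt (dotv x x).
Proof. by []. Qed.

Lemma enorm_ge0 x : 0 <= enorm x.
Proof. exact: sqrtr_ge0. Qed.

Lemma enorm_sqr x : enorm x ^+ 2 = dotv x x.
Proof. exact: sqr_sqrtr (dotvv_ge0 x). Qed.

Lemma enorm_powR x (s : R) : enorm x `^ s = dotv x x `^ (s / 2).
Proof. by rewrite enormE -powR12_sqrt ?dotvv_ge0// -powRrM mulrC. Qed.

Lemma enormZ t x : enorm (t *: x) = `|t| * enorm x.
Proof.
rewrite !enormE dotvZr dotvC dotvZr mulrA -expr2 sqrtrM ?sqr_ge0//.
by rewrite sqrtr_sqr.
Qed.

Lemma enormN x : enorm (- x) = enorm x.
Proof. by rewrite -scaleN1r enormZ normrN1 mul1r. Qed.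

Lemma enorm0 : enorm (0 : 'rV[R]_d) = 0.
Proof. by rewrite -(scale0r 0) enormZ normr0 mul0r. Qed.

Lemma coord_le_enorm x i : `|x 0 i| <= enorm x.
Proof.
rewrite enormE -sqrtr_sqr ler_sqrt ?dotvv_ge0//.
rewrite /dotv (bigD1 i)//= expr2 lerDl.
by apply: sumr_ge0 => j _; rewrite -expr2 sqr_ge0.
Qed.

Lemma norm_le_enorm x : `|x| <= enorm x.
Proof.
rewrite [leLHS]/Num.norm/= mx_normrE; apply/bigmax_leP; split=> /=.
  exact: enorm_ge0.
by move=> [i j] _ /=; rewrite (ord1 i) coord_le_enorm.
Qed.

Lemma enorm_eq0 x : enorm x = 0 -> x = 0.
Proof.
by move=> x0; apply/eqP; rewrite -normr_le0 -x0 norm_le_enorm.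
Qed.

Lemma enorm_gt0 x : x != 0 -> 0 < enorm x.
Proof.
by move=> x0; rewrite lt_def enorm_ge0 andbT;
   apply: contra_neq x0 => /enorm_eq0.
Qed.

(** Expand the square of the norm of [x - <nu, x> nu]. *)
Lemma dotv_unit_le (nu x : 'rV[R]_d) : enorm nu = 1 -> dotv nu x <= enorm x.
Proof.
move=> nu1; have := dotvv_ge0 (x + (- dotv nu x) *: nu).
rewrite dotvDr dotvZr dotvC dotvDr dotvZr (dotvC (x + _)) dotvDr dotvZr.
rewrite -(enorm_sqr nu) nu1 -enorm_sqr (dotvC x nu) => sq.
have [le0|gt0] := leP (dotv nu x) 0; first exact: le_trans le0 (enorm_ge0 x).
by rewrite -(ler_pXn2r (ltn0Sn 1)) ?nnegrE ?enorm_ge0 ?(ltW gt0)//; lra.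
Qed.

Lemma continuous_dotv_comp (T : topologicalType) (f g : T -> 'rV[R]_d) :
  continuous f -> continuous g -> continuous (fun z => dotv (f z) (g z)).
Proof.
move=> cf cg z; rewrite /continuous_at /dotv.
apply: (@cvg_big R 'I_d +%R 0 predT (@add_continuous R) T (nbhs z) _
  (fun i (x : T) => f x 0 i * g x 0 i) (fun i => f z 0 i * g z 0 i)) => i _.
apply: cvgM.
  by apply: (@continuous_comp _ _ _ f (fun v : 'rV_d => v 0 i));
    [exact: cf|exact: coord_continuous].
by apply: (@continuous_comp _ _ _ g (fun v : 'rV_d => v 0 i));
    [exact: cg|exact: coord_continuous].
Qed.

Lemma continuous_enorm : continuous (@enorm R d).
Proof.
move=> x; apply: (@continuous_comp _ _ _ (fun x => dotv x x)).
  by apply: (@continuous_dotv_comp _ id id) => y; exact: cvg_id.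
exact: sqrt_continuous.
Qed.
End Euclidean.

Lemma ler_enorm {R : realType} {d : nat} (x y : 'rV[R]_d) :
  (forall i, `|x 0 i| <= `|y 0 i|) -> enorm x <= enorm y.
Proof.
move=> xy; rewrite !enormE ler_sqrt ?dotvv_ge0//; apply: ler_sum => i _.
by rewrite -!expr2 -(real_normK (num_real (x 0 i)))
  -(real_normK (num_real (y 0 i)))
  ler_pXn2r ?nnegrE.
Qed.

(** * The barrier *)

Section Barrier.
Context {R : realType} {d : nat}.
Variables (s A B : R) (nu : 'rV[R]_d.+1).
Implicit Types x : 'rV[R]_d.+1.

(** The barrier with its pole at the origin.  The absolute value makes it
    continuous everywhere; only its values on [0 <= dotv nu x] matter. *)
Definition barrier x : R :=
  dotv nu x - A * enorm x `^ s + B * `|dotv nu x| `^ s.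

(** First partial derivatives of the barrier on the half space [0 < dotv nu x],
    with powers of the norm written as powers of the polynomial [dotv x x]. *)
Definition barrier_partial (i : 'I_d.+1) x : R :=
  nu 0 i - A * (s * dotv x x `^ (s / 2 - 1) * x 0 i)
  + B * (s * dotv nu x `^ (s - 1) * nu 0 i).

Definition barrier_partial2 (i : 'I_d.+1) x : R :=
  - A * s * (dotv x x `^ (s / 2 - 1)
             + (s - 2) * dotv x x `^ (s / 2 - 1 - 1) * x 0 i ^+ 2)
  + B * (s * (s - 1) * dotv nu x `^ (s - 1 - 1) * nu 0 i ^+ 2).

Lemma continuous_barrier : 0 < s -> continuous barrier.
Proof.
move=> s0; rewrite (_ : barrier = fun x =>
    dotv nu x - A * `|enorm x| `^ s + B * `|dotv nu x| `^ s); last first.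
  by apply/funext => x; rewrite ger0_norm ?enorm_ge0.
have combine (T : topologicalType) (f g : T -> R) : continuous f ->
    continuous g ->
    continuous (fun z => f z - A * `|g z| `^ s + B * `|f z| `^ s).
  move=> cf cg z; have cpow (h : T -> R) : continuous h ->
      `|h w| `^ s @[w --> z] --> `|h z| `^ s.
    move=> ch; apply: (@continuous_comp _ _ _ h (fun t => `|t| `^ s)).
      exact: ch.
    exact: continuous_norm_powR.
  apply: cvgD; first by apply: cvgB; [exact: cf|apply: cvgMl_tmp; exact: cpow].
  by apply: cvgMl_tmp; exact: cpow.
apply: combine; last exact: continuous_enorm.
apply: (@continuous_dotv_comp R d.+1 _ (cst nu) id) => y.
  exact: cst_continuous.
exact: cvg_id.
Qed.

Lemma dotv_gt0_sqr x : 0 < dotv nu x -> 0 < dotv x x.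
Proof.
move=> y0; rewrite -enorm_sqr exprn_gt0// enorm_gt0//.
by apply: contraTneq y0 => ->; rewrite dotv0r ltxx.
Qed.

Let line_coord i x (t : R) :
  is_derive t 1 (fun t => (x + t *: ebase i) 0 i) 1.
Proof.
rewrite (_ : (fun _ => _) = cst (x 0 i) + id); last first.
  by apply/funext => r; rewrite !mxE !eqxx mulr1.
by apply: is_derive_eq; rewrite add0r.
Qed.

Let line_dotv i x (t : R) :
  is_derive t 1 (fun t => dotv nu (x + t *: ebase i)) (nu 0 i).
Proof.
rewrite (_ : (fun _ => _) = cst (dotv nu x) + nu 0 i \*: id); last first.
  by apply/funext => r; rewrite dotvDr dotvZr dotv_ebase mulrC.
by apply: is_derive_eq; rewrite add0r [_ *: _]mulr1.
Qed.

Let line_sqr i x (t : R) :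
  is_derive t 1 (fun t => dotv (x + t *: ebase i) (x + t *: ebase i))
    (2 * (x + t *: ebase i) 0 i).
Proof.
rewrite (_ : (fun _ => _) = cst (dotv x x) + 2 * x 0 i \*: id + id ^+ 2);
  last first.
  apply/funext => r; rewrite dotvDr dotvZr dotvC dotvDr dotvZr !dotv_ebase.
  rewrite -[RHS]/(dotv x x + 2 * x 0 i * r + r ^+ 2) !mxE !eqxx.
  by rewrite [(1 : R) *+ _]/=; ring.
apply: is_derive_eq; rewrite !mxE !eqxx [_ *: _]mulr1 [_ *: _]mulr1 !add0r.
by rewrite /=; ring.
Qed.

Lemma barrier_derive i x (t : R) : 0 < dotv nu (x + t *: ebase i) ->
  is_derive t 1 (fun t => barrier (x + t *: ebase i))
    (barrier_partial i (x + t *: ebase i)).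
Proof.
move=> y0; have q0 := dotv_gt0_sqr _ y0.
have dq := is_derive_powR_comp _ (s / 2) _ _ q0 (line_sqr i x t).
have dy := is_derive_powR_comp _ s _ _ y0 (line_dotv i x t).
have db := is_deriveD (is_deriveB (line_dotv i x t) (is_deriveZ A dq))
  (is_deriveZ B dy).
have cy : {for t, continuous (fun r : R => dotv nu (x + r *: ebase i))}.
  by apply/differentiable_continuous/derivable1_diffP;
   have [] := line_dotv i x t.
apply: near_eq_is_derive (is_derive_eq db _).
  near=> r; rewrite /barrier enorm_powR ger0_norm//.
  apply: ltW; near: r; apply: (cvgr_gt (dotv nu (x + t *: ebase i))) => //.
rewrite /barrier_partial /GRing.scale/=; by field.
Unshelve. all: by end_near. Qed.

Lemma barrier_derive2 i x : 0 < dotv nu x ->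
  is_derive (0 : R) 1 (fun t => barrier_partial i (x + t *: ebase i))
    (barrier_partial2 i x).
Proof.
rewrite -{1}(addr0 x) -(scale0r (ebase i)) => y0; have q0 := dotv_gt0_sqr _ y0.
have dq := is_derive_powR_comp _ (s / 2 - 1) _ _ q0 (line_sqr i x 0).
have dy := is_derive_powR_comp _ (s - 1) _ _ y0 (line_dotv i x 0).
have db := is_deriveD (is_deriveB (is_derive_cst (nu 0 i) (0 : R) 1)
    (is_deriveZ A (is_deriveZ s (is_deriveM dq (line_coord i x 0)))))
  (is_deriveZ B (is_deriveZ (s * nu 0 i) dy)).
move: db; rewrite !(scale0r, addr0) => db.
set D := (X in is_derive _ _ _ X) in db.
have -> : barrier_partial2 i x = D.
  rewrite /D /barrier_partial2 /GRing.scale/=; by field.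
apply: near_eq_is_derive db; near=> r.
rewrite /barrier_partial -[LHS]/(nu 0 i - A * (s * (
  dotv (x + r *: ebase i) (x + r *: ebase i) `^ (s / 2 - 1)
    * (x + r *: ebase i) 0 i)) +
  B * ((s * nu 0 i) * dotv nu (x + r *: ebase i) `^ (s - 1))); ring.
Unshelve. all: by end_near. Qed.

(** With [q = dotv x x] and [y = dotv nu x] the sum is
    [s (B (s - 1) y^(s-2) - A (s - 1 + d) q^((s-2)/2))]; as [y^2 <= q] and
    [s <= 2], the first power dominates the second. *)
Lemma barrier_laplacian_gt0 x : 1 < s -> s <= 2 -> 0 < A ->
  A * (s - 1 + d%:R) < B * (s - 1) -> enorm nu = 1 -> 0 < dotv nu x ->
  0 < \sum_i barrier_partial2 i x.
Proof.
move=> s1 s2 A0 AB nu1 y0; have q0 := dotv_gt0_sqr _ y0.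
rewrite big_split/= -!mulr_sumr big_split/= -!mulr_sumr sumr_const card_ord.
have sqE (z : 'rV[R]_d.+1) : \sum_(i < d.+1) z 0 i ^+ 2 = dotv z z.
  by apply: eq_bigr => i _; rewrite expr2.
rewrite !sqE -(enorm_sqr nu) nu1 expr1n mulr1.
have y_le := dotv_unit_le _ x nu1.
have yq : dotv nu x ^+ 2 <= dotv x x.
  by rewrite -enorm_sqr ler_pXn2r ?nnegrE ?enorm_ge0 ?(ltW y0).
set q := dotv x x in q0 yq *; set y := dotv nu x in y0 yq *.
have -> : (s - 2) * q `^ (s / 2 - 1 - 1) * q = (s - 2) * q `^ (s / 2 - 1).
  rewrite -mulrA; congr (_ * _).
  by rewrite -{2}(powRr1 (ltW q0)) -powRD ?subrK ?(gt_eqF q0) ?implybT.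
(* The exponent [s / 2 - 1] is nonpositive, so [y ^+ 2 <= q] is reversed. *)
have pow_le : q `^ (s / 2 - 1) <= y `^ (s - 1 - 1).
  have -> : s - 1 - 1 = 2%:R * - (1 - s / 2) by field.
  have -> : s / 2 - 1 = - (1 - s / 2) by ring.
  rewrite powRrM powR_mulrn ?(ltW y0)// !powRN.
  rewrite lef_pV2 ?posrE ?powR_gt0 ?exprn_gt0//.
  by apply: ge0_ler_powR; rewrite ?nnegrE ?exprn_ge0 ?(ltW q0) ?(ltW y0)//; lra.
have qpos : 0 < q `^ (s / 2 - 1) by exact: powR_gt0.
move: pow_le qpos; set Y := y `^ _; set Q := q `^ _ => pow_le qpos.
rewrite mulrS -mulr_natl.
have : 0 < (B * (s - 1) - A * (s - 1 + d%:R)) * (s * Q).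
  by rewrite mulr_gt0 ?mulr_gt0//; lra.
have : 0 <= B * (s - 1) * s * (Y - Q).
  apply: mulr_ge0; last by lra.
  apply: mulr_ge0; last by lra.
  apply: ltW; apply: le_lt_trans AB; apply: mulr_ge0; first exact: ltW.
  by rewrite addr_ge0// subr_ge0 ltW.
lra.
Qed.
End Barrier.

(** * Comparison with the barrier *)

Section Comparison.
Context {R : realType} {d : nat}.
Variables (s A B : R) (nu : 'rV[R]_d.+1).
Hypotheses (s_gt1 : 1 < s) (s_le2 : s <= 2) (A_gt0 : 0 < A).
Hypothesis AB : A * (s - 1 + d%:R) < B * (s - 1).
Hypothesis nu_unit : enorm nu = 1.
Variables (u : 'rV[R]_d.+1 -> R) (P0 : 'rV[R]_d.+1).

Let v (z : 'rV[R]_d.+1) : R := barrier s A B nu (z - P0).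

(** At a local maximum every pure second derivative of [u + eps * v] is
    nonpositive, whereas their sum is [eps] times the Laplacian of [v]. *)
Lemma no_interior_max (eps : R) (z : 'rV[R]_d.+1) : 0 < eps ->
  (\forall w \near z, forall i, derivable u w (ebase i)) ->
  (forall i, derivable (partial i u) z (ebase i)) ->
  laplacian u z = 0 -> 0 < dotv nu (z - P0) ->
  ~ (\forall w \near z, u w + eps * v w <= u z + eps * v z).
Proof.
move=> eps0 du ddu lap y0 zmax.
have shiftE w t i : w + t *: ebase i - P0 = w - P0 + t *: ebase i.
  by rewrite addrAC.
have dnear : \forall w \near z, 0 < dotv nu ((w : 'rV[R]_d.+1) - P0).
  have cy : {for z, continuous (fun w : 'rV[R]_d.+1 => dotv nu (w - P0))}.
    apply: (@continuous_dotv_comp R d.+1 _ (cst nu)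
      (fun w : 'rV[R]_d.+1 => w - P0)) => y.
      exact: cst_continuous.
    exact: continuous_shift_sub.
  exact: cvgr_gt cy _ y0.
have cond i : 0 <= - (partial i (partial i u) z
    + eps * barrier_partial2 s A B nu i (z - P0)).
  pose f (t : R) := - (u (z + t *: ebase i) + eps * v (z + t *: ebase i)).
  pose f' (t : R) := - (partial i u (z + t *: ebase i)
    + eps * barrier_partial s A B nu i (z - P0 + t *: ebase i)).
  apply: (@second_derivative_ge0_at_min _ f f' 0).
  - have := near_line z (ebase i) _ dnear.
    have := near_line z (ebase i) _ du.
    apply: filterS2 => t /(_ i) dut; rewrite shiftE => yt.
    have db := barrier_derive s A B nu _ _ _ yt.
    have da := is_derive_along_line _ _ _ _ dut.
    rewrite (_ : f = - ((fun t => u (z + t *: ebase i)) + eps \*: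
      (fun t => barrier s A B nu (z - P0 + t *: ebase i)))); last first.
      by apply/funext => t'; rewrite /f /v shiftE.
    exact: (is_deriveN (is_deriveD da (is_deriveZ eps db))).
  - have dut : derivable (partial i u) (z + 0 *: ebase i) (ebase i).
      by rewrite scale0r addr0.
    have da := is_derive_along_line _ _ _ _ dut.
    have db := barrier_derive2 s A B nu i _ y0.
    rewrite scale0r addr0 in da.
    exact: (is_deriveN (is_deriveD da (is_deriveZ eps db))).
  - have := near_line z (ebase i) _ zmax.
    by apply: filterS => t; rewrite /f scale0r addr0 lerN2.
have := barrier_laplacian_gt0 s A B nu _ s_gt1 s_le2 A_gt0 AB nu_unit y0.
have : 0 <= \sum_i - (partial i (partial i u) z
    + eps * barrier_partial2 s A B nu i (z - P0)).
  by apply: sumr_ge0 => i _; exact: cond.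
rewrite sumrN big_split/= -mulr_sumr -/(laplacian u z) lap add0r oppr_ge0.
by rewrite pmulr_rle0// leNgt => /negbTE ->.
Unshelve. all: by end_near. Qed.

Variables (Omega : set 'rV[R]_d.+1) (r : R).
(* The hypothesis [K_sub] on this set is where the shape of Omega enters. *)
Let K := [set z | [/\ enorm (z - P0) <= r, 0 <= dotv nu (z - P0) & 0 <= v z]].

Hypothesis Omega_open : open Omega.
Hypothesis r_gt0 : 0 < r.
Hypothesis K_sub : forall z, K z -> z != P0 -> Omega z /\ 0 < dotv nu (z - P0).
Hypothesis u_C2 : C2_on Omega u.
Hypothesis u_harmonic : forall P, Omega P -> laplacian u P = 0.
Hypothesis u_cont_P0 : u P @[P --> within Omega (nbhs P0)] --> u P0.
Hypothesis u_max : forall P, Omega P -> u P < u P0.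

Let cont_shift : continuous (fun z : 'rV[R]_d.+1 => z - P0).
Proof. exact: continuous_shift_sub. Qed.

Let cont_y : continuous (fun z : 'rV[R]_d.+1 => dotv nu (z - P0)).
Proof.
apply: (@continuous_dotv_comp R d.+1 _ (cst nu)
  (fun w : 'rV[R]_d.+1 => w - P0)) => //.
exact: cst_continuous.
Qed.

Let cont_e : continuous (fun z : 'rV[R]_d.+1 => enorm (z - P0)).
Proof.
move=> z; apply: (@continuous_comp _ _ _ (fun z : 'rV[R]_d.+1 => z - P0)
  (@enorm R _)).
  exact: cont_shift.
exact: continuous_enorm.
Qed.

Let cont_v : continuous v.
Proof.
move=> z; apply: (@continuous_comp _ _ _ (fun z : 'rV[R]_d.+1 => z - P0)
  (barrier s A B nu)).
  exact: cont_shift.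
by apply: continuous_barrier; exact: lt_trans s_gt1.
Qed.

Let v_P0 : v P0 = 0.
Proof.
have s0 : s != 0 by rewrite gt_eqF// (lt_trans _ s_gt1).
by rewrite /v /barrier subrr dotv0r enorm0 normr0 powR0// !mulr0 subr0 addr0.
Qed.

Let K_P0 : K P0.
Proof.
by rewrite /K /= v_P0 subrr enorm0 dotv0r; split => //; exact: ltW.
Qed.

Let compact_K : compact K.
Proof.
apply: bounded_closed_compact.
  exists (r + `|P0|); split; first exact: num_real.
  move=> M rM z [zr _ _]; apply: le_trans (ltW rM).
  rewrite -{1}(subrK P0 z); apply: le_trans (ler_normD _ _) _.
  by rewrite lerD2r; exact: le_trans (norm_le_enorm _) zr.
have -> : K = (fun z : 'rV[R]_d.+1 => enorm (z - P0)) @^-1` [set t | t <= r] `&`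
    ((fun z : 'rV[R]_d.+1 => dotv nu (z - P0)) @^-1` [set t | 0 <= t] `&`
     v @^-1` [set t | 0 <= t]).
  by apply/seteqP; split=> z /=; [case|move=> [? []]].
by apply: closedI; [|apply: closedI]; apply: preimage_closed => //;
  (exact: closed_le || exact: closed_ge).
Qed.

(* At [P0] continuity is known only from within Omega, which is enough because
   [K] meets the complement of Omega at most in [P0]. *)
Let cont_u_K : {within K, continuous u}.
Proof.
apply/subspace_continuousP => z Kz.
have [->|zP0] := eqVneq z P0.
  move=> V Vu; have := u_cont_P0 V Vu; rewrite !nbhs_simpl /within/=.
  apply: filterS => w wV Kw.
  have [->|wP0] := eqVneq w P0; first exact: nbhs_singleton.
  by apply: wV; have [] := K_sub _ Kw wP0.
apply: cvg_within_filter.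
by have [Oz _] := K_sub _ Kz zP0; have [] := u_C2.1 z Oz.
Qed.

(** The maximum of [u + eps * v] over [K] is at most [u P0], by excluding all
    places where it could be larger. *)
Lemma barrier_comparison :
  exists2 eps : R, 0 < eps & forall z, K z -> eps * v z <= u P0 - u z.
Proof.
have K0 : K !=set0 by exists P0.
have cont_vK : {within K, continuous v} by exact: continuous_subspaceT.
have [b /set_mem Kb vb] := EVT_max_rV K0 compact_K cont_vK.
have b_ge0 : 0 <= v b by rewrite -v_P0; apply: vb; rewrite inE.
(* The part of [K] on the sphere, away from [P0]: there [u] stays below [u P0]
   by a fixed amount [m]. *)
pose S := K `&` [set z | r <= enorm (z - P0)].
have cS : compact S.
  apply: (subclosed_compact _ compact_K) => [|z []//].
  apply: closedI; first exact: (compact_closed (@norm_hausdorff _ _)).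
  apply: (@preimage_closed _ _ (fun z : 'rV[R]_d.+1 => enorm (z - P0))
    [set t | r <= t]).
    by move=> z _; exact: cont_e.
  exact: closed_ge.
have SP0 z : S z -> z != P0.
  by move=> [_ /=]; apply: contraTneq => ->; rewrite subrr enorm0 leNgt r_gt0.
have [m m_gt0 Sm] : exists2 m : R, 0 < m & forall z, S z -> u z <= u P0 - m.
  have [->|/set0P S0] := eqVneq S set0; first by exists 1.
  have cont_uS : {within S, continuous u}.
    by apply: continuous_subspaceW cont_u_K => z [].
  have [c /set_mem Sc uc] := EVT_max_rV S0 cS cont_uS.
  exists (u P0 - u c) => [|z Sz].
    by rewrite subr_gt0 u_max//; have [] := K_sub _ Sc.1 (SP0 _ Sc).
  by rewrite opprB addrC subrK; apply: uc; rewrite inE.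
have b1_gt0 : 0 < v b + 1 by rewrite ltr_wpDl.
(* Small enough for [eps * v <= m] on all of [K], as [v <= v b] there. *)
pose eps := m / (v b + 1).
have eps_gt0 : 0 < eps by rewrite divr_gt0.
exists eps => // z0 Kz0.
have cont_g : {within K, continuous (u + (fun z => eps * v z))}.
  move=> z; apply: continuousD; first exact: cont_u_K.
  apply: continuousM; first exact: cst_continuous.
  exact: cont_vK.
have [c /set_mem Kc gc] := EVT_max_rV K0 compact_K cont_g.
suff g_le : u c + eps * v c <= u P0.
  have : u z0 + eps * v z0 <= u c + eps * v c by apply: gc; rewrite inE.
  by move/le_trans => /(_ _ g_le); rewrite lerBrDl.
have [->|cP0] := eqVneq c P0; first by rewrite v_P0 mulr0 addr0.
have [Oc yc] := K_sub _ Kc cP0.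
have [cr|cr] := leP r (enorm (c - P0)).
  have eps_v : eps * v c <= m.
    rewrite /eps mulrAC ler_pdivrMr// ler_wpM2l ?(ltW m_gt0)//.
    by rewrite (le_trans (vb c _)) ?inE// lerDl.
  by have := Sm c (conj Kc cr); lra.
have [vc|vc] := leP (v c) 0.
  have := u_max _ Oc; have : eps * v c <= 0 by rewrite pmulr_rle0.
  lra.
exfalso; apply: (no_interior_max eps c eps_gt0 _ _ (u_harmonic _ Oc) yc).
- have : \forall w \near c, Omega w by exact: open_nbhs_nbhs.
  by apply: filterS => w Ow i; have [_ /(_ i)[]] := u_C2.1 w Ow.
- by move=> i; have [_ /(_ i)[]] := u_C2.2 i c Oc.
have ev1 : \forall w \near c, enorm ((w : 'rV[R]_d.+1) - P0) < r.
  exact: (cvgr_lt _ (cont_e c)).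
have ev2 : \forall w \near c, 0 < dotv nu ((w : 'rV[R]_d.+1) - P0).
  exact: (cvgr_gt _ (cont_y c)).
have ev3 : \forall w \near c, 0 < v w by exact: (cvgr_gt _ (cont_v c)).
apply: filterS3 ev1 ev2 ev3 => w w1 w2 w3.
by apply: gc; rewrite inE; split; exact: ltW.
Qed.
End Comparison.

(** * The paraboloid inside a domain of class C^(1,alpha) *)

(** The mean value theorem, in the form of a first order expansion with slope
    [g] and an error controlled by the oscillation of the derivative. *)
Lemma line_increment_bound {R : realType} {V : normedModType R} (f : V -> R)
    (x v : V) (t g M : R) :
  (forall tau, `|tau| <= `|t| -> derivable f (x + tau *: v) v /\
      `|'D_v f (x + tau *: v) - g| <= M) ->
  `|f (x + t *: v) - f x - t * g| <= M * `|t|.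
Proof.
move=> Hf; pose h (tau : R) := f (x + tau *: v).
suff [tau tau_t hE] : exists2 tau, `|tau| <= `|t| &
    h t - h 0 = 'D_v f (x + tau *: v) * t.
  have -> : f x = h 0 by rewrite /h scale0r addr0.
  rewrite hE mulrC -mulrBr normrM mulrC ler_wpM2r//.
  by have [] := Hf _ tau_t.
have dh (tau : R) : `|tau| <= `|t| -> is_derive tau 1 h ('D_v f (x + tau *: v)).
  by move=> /Hf [fd _]; exact: is_derive_along_line.
have [t0|t0] := leP 0 t.
- have in_t tau : tau \in `[0, t]%R -> `|tau| <= `|t|.
    by rewrite in_itv/= => /andP[? ?]; rewrite !ger0_norm.
  have [tau taut||c ct] :=
    @MVT_segment _ h (fun tau => 'D_v f (x + tau *: v)) 0 t t0.
  + by apply/dh/in_t/subset_itv_oo_cc.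
  + by apply: derivable_within_continuous => tau /in_t /dh [].
  + by rewrite subr0 => hE; exists c => //; exact: in_t.
- have in_t tau : tau \in `[t, 0]%R -> `|tau| <= `|t|.
    by rewrite in_itv/= => /andP[? ?]; rewrite !ler0_norm ?lerN2// ltW.
  have [tau taut||c ct] :=
    @MVT_segment _ h (fun tau => 'D_v f (x + tau *: v)) t 0 (ltW t0).
  + by apply/dh/in_t/subset_itv_oo_cc.
  + by apply: derivable_within_continuous => tau /in_t /dh [].
  + move=> hE; exists c; first exact: in_t.
    by rewrite -opprB hE sub0r mulrN opprK.
Qed.

(** Move from [a] to [x] one coordinate at a time.  The intermediate points have
    coordinates no further from those of [a] than the ones of [x], so the Holder
    bound on the partial derivatives applies at each of them. *)
Lemma C1alpha_taylor {R : realType} (alpha : R) (W : set 'rV[R]_2)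
    (phi : 'rV[R]_2 -> R) (a : 'rV[R]_2) :
  0 < alpha -> open W -> W a -> C1alpha_on alpha W phi ->
  exists C delta : R, [/\ 0 <= C, 0 < delta & forall x, enorm (x - a) < delta ->
    `|phi x - phi a - \sum_j partial j phi a * (x - a) 0 j|
      <= C * enorm (x - a) `^ (1 + alpha)].
Proof.
move=> alpha0 Wo Wa [phiC1 [C0 holder]].
pose C := Num.max C0 0.
have C_ge0 : 0 <= C by rewrite le_max lexx orbT.
have /nbhs_ballP[delta /= delta0 Wball] : nbhs a W by exact: open_nbhs_nbhs.
exists (2 * C), delta; split=> [||x xa]; first by rewrite mulr_ge0.
  exact: delta0.
pose e := enorm (x - a).
have near_a p : (forall i, `|(p - a) 0 i| <= `|(x - a) 0 i|) ->
    W p /\ forall i, `|partial i phi p - partial i phi a| <= C * e `^ alpha.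
  move=> /ler_enorm pe; have Wp : W p.
    apply: Wball; rewrite -ball_normE/= distrC.
    by apply: le_lt_trans (norm_le_enorm _) _; exact: le_lt_trans pe xa.
  split=> // i; apply: le_trans (holder i p a Wp Wa) _.
  apply: (@le_trans _ _ (C * enorm (p - a) `^ alpha)).
    by rewrite ler_wpM2r ?powR_ge0// le_max lexx.
  rewrite ler_wpM2l//.
  by apply: ge0_ler_powR => //; rewrite ?nnegrE ?enorm_ge0 ?ltW.
have l1 : lift ord0 ord0 = 1 :> 'I_2 by exact/val_inj.
have xE : x = a + (x - a) 0 0 *: ebase 0 + (x - a) 0 1 *: ebase 1.
  rewrite -[LHS](subrK a) addrC -addrA; congr (_ + _).
  by rewrite {1}[x - a]row_sum_delta !big_ord_recl big_ord0 addr0 l1.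
set s0 := (x - a) 0 0 in xE; set s1 := (x - a) 0 1 in xE.
have ebaseE (i j : 'I_2) : (ebase i : 'rV[R]_2) 0 j = (j == i)%:R.
  by rewrite mxE.
have step0 : `|phi (a + s0 *: ebase 0) - phi a - s0 * partial 0 phi a|
    <= C * e `^ alpha * `|s0|.
  apply: line_increment_bound => tau tau_le.
  have [|Wp dp] := near_a (a + tau *: ebase 0).
    move=> i; rewrite addrAC subrr add0r mxE ebaseE.
    by have [->|_] := eqVneq i 0; rewrite ?mulr1// mulr0 normr0.
  by split; [have [_ /(_ 0)[]] := phiC1 _ Wp|exact: dp].
have step1 : `|phi x - phi (a + s0 *: ebase 0) - s1 * partial 1 phi a|
    <= C * e `^ alpha * `|s1|.
  rewrite {1}xE; apply: line_increment_bound => tau tau_le.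
  have [|Wp dp] := near_a (a + s0 *: ebase 0 + tau *: ebase 1).
    move=> i; have -> : (a + s0 *: ebase 0 + tau *: ebase 1 - a) 0 i =
        s0 * (i == 0)%:R + tau * (i == 1)%:R.
      rewrite -!ebaseE; move: (ebase 0) (ebase 1) => v0 v1.
      by rewrite !mxE; ring.
    have [->|->] : i = 0 \/ i = 1.
      by case: i => [[|[|//]] ?]; [left|right]; exact/val_inj.
    by rewrite /= mulr1 mulr0 addr0.
    by rewrite /= mulr1 mulr0 add0r.
  by split; [have [_ /(_ 1)[]] := phiC1 _ Wp|exact: dp].
rewrite !big_ord_recl big_ord0 addr0 l1 -/s0 -/s1.
have -> : e `^ (1 + alpha) = e * e `^ alpha.
  by rewrite -(@mulr_powRB1 _ e (1 + alpha)) ?enorm_ge0 ?addr_gt0// addrC addKr.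
have M_ge0 : 0 <= C * e `^ alpha by rewrite mulr_ge0 ?powR_ge0.
have s0_le : C * e `^ alpha * `|s0| <= C * e `^ alpha * e.
  by rewrite ler_wpM2l// coord_le_enorm.
have s1_le : C * e `^ alpha * `|s1| <= C * e `^ alpha * e.
  by rewrite ler_wpM2l// coord_le_enorm.
apply: (@le_trans _ _ (C * e `^ alpha * `|s0| + C * e `^ alpha * `|s1|)).
  apply: le_trans (lerD step0 step1); apply: le_trans _ (ler_normD _ _).
  by rewrite le_eqVlt; apply/orP; left; apply/eqP; congr `|_|; ring.
lra.
Qed.

Lemma dotv_outward_vector {R : realType} (i : 'I_3) (sg : bool)
    (phi : 'rV[R]_2 -> R) (Q x : 'rV[R]_3) :
  dotv (outward_vector i sg phi Q) x =
  (-1) ^+ sg *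
    (x 0 i - \sum_j partial j phi (other_coords i Q) * x 0 (lift i j)).
Proof.
rewrite dotvC dotvZr; congr (_ * _).
rewrite dotvDr dotv_ebase dotvNr; congr (_ - _).
rewrite /dotv; under eq_bigr do rewrite summxE mulr_sumr.
rewrite exchange_big; apply: eq_bigr => j _ /=.
rewrite -dotv_ebase /dotv mulr_sumr; apply: eq_bigr => k _.
by rewrite mxE mulrCA.
Qed.

Lemma outward_vector_neq0 {R : realType} (i : 'I_3) (sg : bool)
    (phi : 'rV[R]_2 -> R) (Q : 'rV[R]_3) : outward_vector i sg phi Q != 0.
Proof.
have : dotv (outward_vector i sg phi Q) (ebase i) = (-1) ^+ sg.
  rewrite dotv_outward_vector big1 ?subr0 ?mxE ?eqxx ?mulr1// => j _.
  by rewrite mxE eqxx/= eq_sym (negPf (neq_lift i j)) mulr0.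
by apply: contra_eq_neq => ->; rewrite dotvC dotv0r eq_sym signr_eq0.
Qed.

Lemma enorm_other_coords {R : realType} (i : 'I_3) (x : 'rV[R]_3) :
  enorm (other_coords i x) <= enorm x.
Proof.
rewrite !enormE ler_sqrt ?dotvv_ge0// [leRHS]/dotv (bigD1_ord i)//=.
rewrite ler_wpDl -?expr2 ?sqr_ge0//; apply: ler_sum => j _.
by rewrite !mxE.
Qed.

(** In the chart, Omega is where [graph_fun] is negative.  This function
    vanishes at [Q], has gradient [N] there and differs from its linearization by
    at most [C e^(1+alpha)]; a depth of [(C + 1) e^(1+alpha) / |N|] below the tangent
    plane therefore makes it negative. *)
Lemma C1alpha_chart_inner_paraboloid {R : realType} (Omega : set 'rV[R]_3)
    (alpha : R) (Q : 'rV[R]_3) (i : 'I_3) (sg : bool) U W phi :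
  0 < alpha -> boundary Omega Q -> C1alpha_chart Omega alpha Q i sg U W phi ->
  let N := outward_vector i sg phi Q in
  exists K delta : R, [/\ 0 < K, 0 < delta & forall z, z != Q ->
    enorm (z - Q) < delta ->
    K * enorm (z - Q) `^ (1 + alpha) <= dotv (- ((enorm N)^-1 *: N)) (z - Q) ->
    Omega z].
Proof.
move=> alpha0 bQ [Uo UQ Wo UW phiC bU sideU] N.
have [C [d1 [C_ge0 d1_gt0 taylor]]] :=
  C1alpha_taylor _ _ _ _ alpha0 Wo (UW _ UQ) phiC.
have /nbhs_ballP[d2 /= d2_gt0 Uball] : nbhs Q U by exact: open_nbhs_nbhs.
have N_gt0 : 0 < enorm N by apply: enorm_gt0; exact: outward_vector_neq0.
exists ((C + 1) / enorm N), (Num.min d1 d2); split.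
- by rewrite divr_gt0// ltr_wpDl.
- by rewrite lt_min d1_gt0.
move=> z zQ; rewrite lt_min => /andP[zd1 zd2] depth.
have Uz : U z.
  apply: Uball; rewrite -ball_normE/= distrC.
  exact: le_lt_trans (norm_le_enorm _) zd2.
apply/(sideU z Uz); have /(bU Q UQ) graphQ := bQ.
set e := enorm (z - Q) in depth zd1.
have e_gt0 : 0 < e by rewrite enorm_gt0// subr_eq0.
have coordsB : other_coords i (z - Q) = other_coords i z - other_coords i Q.
  by apply/rowP => j; rewrite !mxE.
have {}taylor := taylor (other_coords i z).
rewrite -coordsB in taylor.
have {}taylor := taylor (le_lt_trans (enorm_other_coords i (z - Q)) zd1).
have pow_le : C * enorm (other_coords i (z - Q)) `^ (1 + alpha)
    <= C * e `^ (1 + alpha).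
  rewrite ler_wpM2l//; apply: ge0_ler_powR; rewrite ?nnegrE ?enorm_ge0//.
    by rewrite addr_ge0// ltW.
  exact: enorm_other_coords.
have {}taylor := le_trans taylor pow_le.
have {}depth : (C + 1) * e `^ (1 + alpha) <= - dotv N (z - Q).
  move: depth; rewrite dotvC dotvNr dotvZr dotvC -mulrN mulrAC mulrC.
  by rewrite ler_pM2l ?invr_gt0.
rewrite dotv_outward_vector in depth.
have epow_gt0 : 0 < e `^ (1 + alpha) by exact: powR_gt0.
move: taylor graphQ; rewrite /graph_fun.
under eq_bigr do rewrite mxE.
move: depth; rewrite !mxE.
have [->|->] : (-1) ^+ sg = 1 :> R \/ (-1) ^+ sg = -1 :> R.
  by clear; case: (sg); [right|left].
all: rewrite ler_norml => d /andP[t1 t2] g; lra.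
Qed.

(** * The boundary point lemma *)

(** The Hopf lemma for any domain containing a paraboloid of order [1 + alpha]
    with vertex at the boundary point. *)
Lemma hopf_inner_paraboloid {R : realType} {d : nat} (alpha K delta : R)
    (Omega : set 'rV[R]_d.+1) (u : 'rV[R]_d.+1 -> R) (P0 nu : 'rV[R]_d.+1) :
  0 < alpha -> alpha <= 1 -> 0 < K -> 0 < delta -> enorm nu = 1 ->
  (forall z, z != P0 -> enorm (z - P0) < delta ->
    K * enorm (z - P0) `^ (1 + alpha) <= dotv nu (z - P0) -> Omega z) ->
  open Omega -> C2_on Omega u ->
  (forall P, Omega P -> laplacian u P = 0) ->
  u P @[P --> within Omega (nbhs P0)] --> u P0 ->
  (forall P, Omega P -> u P < u P0) ->
  exists c r : R, [/\ 0 < c, 0 < r & forall t, 0 < t <= r ->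
    Omega (P0 + t *: nu) /\ c * t <= u P0 - u (P0 + t *: nu)].
Proof.
move=> alpha0 alpha1 K0 delta0 nu1 inner Oo uC2 uharm ucont umax.
(* [B] is chosen so that [B alpha = A (d + 1 + alpha)], slightly more than the
   [A (d + alpha)] required for strict subharmonicity in dimension [d + 1]. *)
pose s := 1 + alpha; pose A := 2 * K; pose B := A * ((d%:R + 1) / alpha + 1).
have [s1 s2] : 1 < s /\ s <= 2 by rewrite /s; split; lra.
have A0 : 0 < A by rewrite mulr_gt0.
have d0 : 0 <= d%:R :> R by exact: ler0n.
have BE : B * (s - 1) = A * (d%:R + 1 + alpha).
  by rewrite /B /s; field; rewrite gt_eqF.
have AB : A * (s - 1 + d%:R) < B * (s - 1) by rewrite BE ltr_pM2l// /s; lra.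
have A_le_B : A <= B.
  by rewrite ler_peMr ?(ltW A0)// lerDr divr_ge0 ?(ltW alpha0)// addr_ge0.
have B0 : 0 < B by exact: lt_le_trans A_le_B.
(* The second bound makes [B t^(1+alpha) <= t] for [0 <= t <= r]. *)
pose r := Num.min (delta / 2) (B^-1 `^ alpha^-1).
have r0 : 0 < r by rewrite lt_min divr_gt0// powR_gt0 ?invr_gt0.
have r_delta : r < delta.
  rewrite (@le_lt_trans _ _ (delta / 2)) ?ge_min ?lexx//.
  by rewrite ltr_pdivrMr// ltr_pMr// ltr1n.
have powS (t : R) : 0 <= t -> t `^ s = t * t `^ alpha.
  move=> t0; rewrite -(@mulr_powRB1 _ t s) ?(lt_trans _ s1)//.
  by rewrite /s [1 + alpha]addrC addrK.
have Bpow (t : R) : 0 <= t <= r -> B * t `^ s <= t.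
  move=> /andP[t0 tr]; rewrite powS// mulrCA ler_piMr//.
  have -> : 1 = B * (B^-1 `^ alpha^-1) `^ alpha.
    rewrite -powRrM mulVf ?gt_eqF// powRr1 ?invr_ge0 ?(ltW B0)//.
    by rewrite mulfV ?gt_eqF.
  rewrite ler_wpM2l ?(ltW B0)//.
  apply: ge0_ler_powR; rewrite ?nnegrE ?powR_ge0 ?(ltW alpha0)//.
  by rewrite (le_trans tr)// ge_min lexx orbT.
have Ksub z : [/\ enorm (z - P0) <= r, 0 <= dotv nu (z - P0)
      & 0 <= barrier s A B nu (z - P0)] ->
    z != P0 -> Omega z /\ 0 < dotv nu (z - P0).
  move=> [er y0]; rewrite /barrier ger0_norm// => v0 zP0.
  have e0 : 0 < enorm (z - P0) by rewrite enorm_gt0// subr_eq0.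
  have yr : 0 <= dotv nu (z - P0) <= r.
    by rewrite y0 (le_trans (dotv_unit_le _ _ nu1)).
  have By := Bpow _ yr.
  have depth : K * enorm (z - P0) `^ s <= dotv nu (z - P0).
    by move: v0 By; rewrite /A; lra.
  split; first by apply: inner => //; exact: le_lt_trans er r_delta.
  by apply: lt_le_trans depth; rewrite mulr_gt0// powR_gt0.
have [c c0 cK] := @barrier_comparison R d s A B nu s1 s2 A0 AB nu1 u P0 Omega r
  Oo r0 Ksub uC2 uharm ucont umax.
exists c, r; split=> // t /andP[t0 tr].
have PE : P0 + t *: nu - P0 = t *: nu by rewrite addrC addKr.
have yE : dotv nu (t *: nu) = t by rewrite dotvZr -enorm_sqr nu1 expr1n mulr1.
have eE : enorm (t *: nu) = t by rewrite enormZ nu1 mulr1 gtr0_norm.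
have v_ge : t <= barrier s A B nu (t *: nu).
  rewrite /barrier yE eE gtr0_norm// -addrA lerDl addrC subr_ge0.
  by rewrite ler_wpM2r// powR_ge0.
have Kz : [/\ enorm (P0 + t *: nu - P0) <= r, 0 <= dotv nu (P0 + t *: nu - P0)
      & 0 <= barrier s A B nu (P0 + t *: nu - P0)].
  by rewrite PE yE eE; split=> //; [exact: ltW|exact: le_trans (ltW t0) v_ge].
split.
  apply: (proj1 (Ksub _ Kz _)); rewrite -subr_eq0 PE.
  by apply: contraTneq t0 => tnu; rewrite -eE tnu enorm0 ltxx.
apply: le_trans (cK _ Kz); rewrite PE ler_wpM2l// ltW//.
Qed.

(** The inner points [P0 - t n] tend to [P0] along the filter defining the
    normal derivative, so a bound on the quotients at these points passes to
    the limit, which is known to exist. *)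
Lemma normal_derivative_ge {R : realType} (Omega : set 'rV[R]_3)
    (u : 'rV[R]_3 -> R) (P0 n : 'rV[R]_3) (c r : R) :
  enorm n = 1 -> 0 < r ->
  (forall t, 0 < t <= r ->
    Omega (P0 - t *: n) /\ c * t <= u P0 - u (P0 - t *: n)) ->
  normal_derivable Omega u P0 n -> c <= normal_derivative Omega u P0 n.
Proof.
move=> n1 r0 inw qcvg.
have near_in : \forall t \near 0^'+, 0 < t <= r.
  have := nbhs_right_le r0; have := nbhs_right_gt (0 : R).
  by apply: filterS2 => t -> ->.
have path : P0 - t *: n @[t --> 0^'+] --> interior_normal_filter Omega P0 n.
  move=> V; rewrite /interior_normal_filter /within/= nbhs_simpl => VP0.
  have := near_line P0 (- n) _ VP0.
  move=> near0; have {near0} near0 : \forall t \near 0^'+,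
      (Omega `&` normal_line P0 n) (P0 + t *: - n) -> V (P0 + t *: - n).
    by apply: filterS near0 => t Vt _.
  suff : \forall t \near 0^'+, V (P0 - t *: n) by [].
  near=> t; rewrite -scalerN.
  have t_in : 0 < t <= r by near: t.
  have : (Omega `&` normal_line P0 n) (P0 + t *: - n) -> V (P0 + t *: - n).
    by near: t.
  apply; split; first by rewrite scalerN; exact: (inw t t_in).1.
  by exists (- t); rewrite scalerN scaleNr.
have quot : normal_quotient u P0 (P0 - t *: n) @[t --> 0^'+] -->
    normal_derivative Omega u P0 n.
  exact: cvg_comp path qcvg.
apply: cvgr_to_ge quot _; near=> t.
have t_in : 0 < t <= r by near: t.
have /andP[t0 _] := t_in.
rewrite /normal_quotient opprB addrCA subrr addr0 enormZ n1 mulr1 gtr0_norm//.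
by rewrite ler_pdivlMr//; exact: (inw t t_in).2.
Unshelve. all: by end_near. Qed.

Theorem theorem2p5 (R : realType) (Omega : set 'rV[R]_3) (alpha : R)
    (u : 'rV[R]_3 -> R) (P0 n : 'rV[R]_3)
    (Omega_domain : domain Omega) (Omega_bounded : bounded_set Omega)
    (alpha_gt0 : 0 < alpha) (alpha_le1 : alpha <= 1)
    (Omega_C1alpha : C1alpha_boundary Omega alpha)
    (u_C2 : C2_on Omega u)
    (u_harmonic : forall P, Omega P -> laplacian u P = 0)
    (P0_boundary : boundary Omega P0)
    (u_cont_P0 : u P @[P --> within Omega (nbhs P0)] --> u P0)
    (u_max : forall P, Omega P -> u P < u P0)
    (n_normal : exterior_unit_normal Omega alpha P0 n) :
  normal_derivable Omega u P0 n -> 0 < normal_derivative Omega u P0 n.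
Proof.
case: Omega_domain => Omega_open _ _.
have [i [sg [U [W [phi [chart nE]]]]]] := n_normal.
have [K [delta [K_gt0 delta_gt0]]] :=
  C1alpha_chart_inner_paraboloid _ _ _ _ _ _ _ _ alpha_gt0 P0_boundary chart.
rewrite -nE => inner.
have n1 : enorm n = 1.
  have N0 := enorm_gt0 _ (outward_vector_neq0 i sg phi P0).
  by rewrite nE enormZ ger0_norm ?mulVf ?gt_eqF// invr_ge0 ltW.
have nu1 : enorm (- n) = 1 by rewrite enormN.
have [c [r [c_gt0 r_gt0 inward]]] := hopf_inner_paraboloid _ _ _ _ _ _ _
  alpha_gt0 alpha_le1 K_gt0 delta_gt0 nu1 inner Omega_open u_C2 u_harmonic
  u_cont_P0 u_max.
move=> dn; apply: lt_le_trans c_gt0 _.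
apply: (normal_derivative_ge _ _ _ _ _ r n1 r_gt0 _ dn) => t t_in.
by rewrite -scalerN; exact: inward.
Qed.
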